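(* Let $(\Omega,\mathcal{F},\mathbf{P})$ be a probability space. (1) If $(X_t,\mathcal{F}_t)$ is a test supermartingale, then $X_\infty:=\lim_{t\to\infty}X_t$ exists almost surely and $1/X_\infty$ is a Bayes factor for $\mathbf{P}$. (2) Suppose $B$ is a precise Bayes factor for $\mathbf{P}$. Then there is a test martingale $(X_t)$ such that $B=1/X_\infty$ almost surely, where $X_\infty:=\lim_{t\to\infty}X_t$. Moreover, for any filtration $(\mathcal{F}_t)$ such that $B$ is $\mathcal{F}_\infty$-measurable, there is a test martingale $(X_t,\mathcal{F}_t)$ such that $B=1/X_\infty$ almost surely.
   Context: Conventions: $1/0=\infty$, $1/\infty=0$. Random variables may take the values $\pm\infty$. Time: the index $t$ ranges over $\{0,1,2,\ldots\}$ (discrete time) or $[0,\infty)$ (continuous time). A filtration $(\mathcal{F}_t)$ is an indexed family of sub-$\sigma$-algebras of $\mathcal{F}$ with $\mathcal{F}_s\subseteq\mathcal{F}_t$ for $s<t$; $\mathcal{F}_\infty$ denotes the $\sigma$-algebra generated by $\bigcup_t\mathcal{F}_t$. $(X_t,\mathcal{F}_t)$ is a supermartingale if $(\mathcal{F}_t)$ is a filtration, each $X_t$ is $\mathcal{F}_t$-measurable and integrable, and $\mathbf{E}(X_t\mid\mathcal{F}_s)\le X_s$ a.s. for all $s<t$; it is a martingale if equality holds a.s. for all $s<t$. A process $(X_t)$ written without a filtration is called a (super)martingale if it is one with respect to the filtration it generates, $\mathcal{F}_t=\sigma(X_s: s\le t)$. In continuous time it is always assumed that the paths of $(X_t)$ are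 right-continuous almost surely, and that the filtration $(\mathcal{F}_t)$ in $(X_t,\mathcal{F}_t)$ satisfies the usual conditions: each $\mathcal{F}_t$ contains all subsets of every $E\in\mathcal{F}$ with $\mathbf{P}(E)=0$ (in particular the probability space is complete), and $\mathcal{F}_t=\bigcap_{s>t}\mathcal{F}_s$. (When a continuous-time process is given without a filtration, its generated filtration need not satisfy the usual conditions; one may then complete the space and replace the filtration by its usual augmentation, which preserves the (super)martingale property.) A test supermartingale is a supermartingale with $X_t\ge 0$ for all $t$ and $\mathbf{E}(X_0)\le 1$. A test martingale is a martingale with $X_t\ge0$ for all $t$ and $\mathbf{E}(X_0)=1$. A Bayes factor for $\mathbf{P}$ is a measurable function $B:\Omega\to[0,\infty]$ with $\int(1/B)\,d\mathbf{P}\le 1$; it is precise if $\int(1/B)\,d\mathbf{P}=1$. (On the null set where $X_\infty$ does not exist, $X_\infty$ may be assigned an arbitrary value making it measurable.) *)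

(* Defs.v *)
From HB Require Import structures.
From mathcomp Require Import all_boot all_order all_algebra.
From mathcomp Require Import all_classical all_reals all_analysis measurable_realfun.

Set Implicit Arguments.
Unset Strict Implicit.
Unset Printing Implicit Defensive.
Import Order.TTheory GRing.Theory Num.Theory.
Import numFieldNormedType.Exports.

Local Open Scope classical_set_scope.
Local Open Scope ring_scope.

(* Random variables are functions to [\bar R].  The reciprocal [x^-1] of
   [ereal_scope] satisfies [0^-1 = +oo] and [+oo^-1 = 0].
   Time is [nat] (discrete) or [{nonneg R}] (continuous); the notions that make
   sense for both are stated over an arbitrary partially ordered index type. *)

Section StochasticProcesses.
Context {d : measure_display} {Omega : measurableType d} {R : realType}.
Context (P : probability Omega R).

Definition measurable_wrt (G : set_system Omega) (f : Omega -> \bar R) : Prop :=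
  preimage_set_system setT f measurable `<=` G.

(* [Y] is a version of the conditional expectation E(Z | G). *)
Definition is_cond_exp (G : set_system Omega) (Z Y : Omega -> \bar R) : Prop :=
  [/\ measurable_wrt G Y,
      P.-integrable setT Y &
      forall A, G A -> (\int[P]_(w in A) Y w = \int[P]_(w in A) Z w)%E].

Definition bayes_factor (B : Omega -> \bar R) : Prop :=
  [/\ measurable_fun setT B,
      forall w, (0 <= B w)%E &
      (\int[P]_w (B w)^-1 <= 1)%E].

Definition precise_bayes_factor (B : Omega -> \bar R) : Prop :=
  bayes_factor B /\ (\int[P]_w (B w)^-1 = 1)%E.

Section AnyTime.
Context {disp : Order.disp_t} {I : porderType disp}.
Implicit Types (F : I -> set_system Omega) (X : I -> Omega -> \bar R).

Definition filtration F : Prop :=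
  [/\ forall t, sigma_algebra setT (F t),
      forall t, F t `<=` measurable &
      forall s t, (s < t)%O -> F s `<=` F t].

Definition filtration_infty F : set_system Omega := <<s \bigcup_t F t >>.

Definition natural_filtration X : I -> set_system Omega := fun t =>
  <<s \bigcup_(s in [set s | (s <= t)%O]) preimage_set_system setT (X s) measurable >>.

Definition adapted_integrable F X : Prop :=
  forall t, measurable_wrt (F t) (X t) /\ P.-integrable setT (X t).

Definition supermartingale F X : Prop :=
  [/\ filtration F, adapted_integrable F X &
      forall s t, (s < t)%O -> exists Y, is_cond_exp (F s) (X t) Y /\
        {ae P, forall w, (Y w <= X s w)%E}].

Definition martingale F X : Prop :=
  [/\ filtration F, adapted_integrable F X &
      forall s t, (s < t)%O -> exists Y, is_cond_exp (F s) (X t) Y /\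
        {ae P, forall w, Y w = X s w}].

(* The initial time is passed as [t0]. *)
Definition test_supermartingale_from (t0 : I) F X : Prop :=
  [/\ supermartingale F X,
      forall t w, (0 <= X t w)%E &
      (\int[P]_w X t0 w <= 1)%E].

Definition test_martingale_from (t0 : I) F X : Prop :=
  [/\ martingale F X,
      forall t w, (0 <= X t w)%E &
      (\int[P]_w X t0 w = 1)%E].

(* [Phi] is the filter on [I] of times tending to infinity. *)
Definition converges_ae (Phi : set_system I) X : Prop :=
  {ae P, forall w, exists l : \bar R, X t w @[t --> Phi] --> l}.

(* [Xoo] is the almost sure limit of [X], with arbitrary values in [0, +oo]
   where the limit does not exist. *)
Definition is_limit_variable (Phi : set_system I) X (Xoo : Omega -> \bar R) :
    Prop :=
  [/\ measurable_fun setT Xoo,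
      forall w, (0 <= Xoo w)%E &
      {ae P, forall w, X t w @[t --> Phi] --> Xoo w}].

Definition limit_gives_bayes_factor (Phi : set_system I) X : Prop :=
  [/\ converges_ae Phi X,
      exists Xoo, is_limit_variable Phi X Xoo &
      forall Xoo, is_limit_variable Phi X Xoo ->
        bayes_factor (fun w => (Xoo w)^-1)%E].

Definition inverse_of_limit (Phi : set_system I) X (B : Omega -> \bar R) :
    Prop :=
  exists Xoo, is_limit_variable Phi X Xoo /\
    {ae P, forall w, B w = ((Xoo w)^-1)%E}.

End AnyTime.

Definition test_supermartingale_discrete
    (F : nat -> set_system Omega) (X : nat -> Omega -> \bar R) : Prop :=
  test_supermartingale_from 0%N F X.

Definition test_martingale_discrete
    (F : nat -> set_system Omega) (X : nat -> Omega -> \bar R) : Prop :=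
  test_martingale_from 0%N F X.

Definition infty_continuous : set_system {nonneg R} :=
  (fun s : R => `|s|%:nng) @ +oo.

(* For [s] to the right of [t >= 0], [`|s|%:nng] is just [s] as an element of
   [{nonneg R}]. *)
Definition right_continuous_paths (X : {nonneg R} -> Omega -> \bar R) : Prop :=
  {ae P, forall w, forall t : {nonneg R},
    X `|s|%:nng w @[s --> t%:num^'+] --> X t w}.

Definition usual_conditions (F : {nonneg R} -> set_system Omega) : Prop :=
  (forall t E N, measurable E -> P E = 0%E -> N `<=` E -> F t N) /\
  (forall t, F t = \bigcap_(s in [set s | (t < s)%O]) F s).

Definition test_supermartingale_continuous
    (F : {nonneg R} -> set_system Omega) (X : {nonneg R} -> Omega -> \bar R) :
    Prop :=
  [/\ test_supermartingale_from 0%:nng F X,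
      right_continuous_paths X &
      usual_conditions F].

Definition test_martingale_continuous
    (F : {nonneg R} -> set_system Omega) (X : {nonneg R} -> Omega -> \bar R) :
    Prop :=
  [/\ test_martingale_from 0%:nng F X,
      right_continuous_paths X &
      usual_conditions F].

(* Processes given without a filtration; in continuous time the generated
   filtration is not required to satisfy the usual conditions. *)
Definition own_test_martingale_discrete (X : nat -> Omega -> \bar R) : Prop :=
  test_martingale_discrete (natural_filtration X) X.

Definition own_test_martingale_continuous
    (X : {nonneg R} -> Omega -> \bar R) : Prop :=
  test_martingale_from 0%:nng (natural_filtration X) X /\
  right_continuous_paths X.

End StochasticProcesses.

(* Main.v *)
Require Import Defs.
From HB Require Import structures.
From mathcomp Require Import all_boot all_order all_algebra.
From mathcomp Require Import lra.
From mathcomp Require Import all_classical all_reals all_analysis measurable_realfun.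
Import Order.TTheory GRing.Theory Num.Theory.
Import numFieldNormedType.Exports.
Local Open Scope classical_set_scope.
Local Open Scope ring_scope.

(** Why the theorem holds.

    The first part is Doob's convergence theorem followed by Fatou's lemma.  The
    convergence is obtained here from Dubins' form of the upcrossing inequality,
    which suits nonnegative supermartingales [X]: whoever buys at the level [a],
    sells at the level [b] and reinvests everything multiplies the capital by
    [b / a] at every upcrossing, and this capital is again a nonnegative
    supermartingale, so that [k] upcrossings have probability at most
    [(a / b) ^+ k] ([upcrosses_bound], [dubins]).  The bound holds along every
    finite list of times.  Hence almost every path has, for all rational levels,
    boundedly many upcrossings along a given sequence of times
    ([bounded_upcrossings_ae]), and such a path has a limit along these times at
    infinity and a right limit at every time ([cvg_sampled_infty],
    [cvg_sampled_right]).  In discrete time the sequence consists of all times;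
    in continuous time it consists of the rational ones, and right-continuity
    extends the convergence to the others.

    For the second part, put [Z] for the reciprocal of [B], which has
    expectation [1].  Without a prescribed filtration the constant process [Z]
    will do.  With one, [X t] is the conditional expectation of [Z] given [F t],
    which is a Radon-Nikodym derivative ([cond_exp_exists]).  The first part
    provides a limit, and it is [Z] by Levy's upward theorem ([levy_upward]):
    conditional expectations of one variable are uniformly integrable
    ([cond_exp_limit]), so that the limit and [Z] have the same integrals over
    all sets of the filtration, which generate the sigma-algebra for which both
    are measurable.  In continuous time the conditional expectations have to be
    chosen with right-continuous paths ([right_continuous_version]): the right
    limits along rational times exist by the bound on upcrossings, are
    measurable because the filtration is right-continuous, and have the right
    integrals again by uniform integrability. *)

(** * Sub-sigma-algebras *)

Section SubSigmaAlgebra.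
Context {d : measure_display} {Omega : measurableType d} {R : realType}.
Implicit Types (G H : set_system Omega) (f : Omega -> \bar R).

Lemma measurable_wrtP G f : sigma_algebra setT G ->
  measurable_wrt G f <-> measurable_fun [set: g_sigma_algebraType G] f.
Proof.
move=> sG; have GE := measurable_g_measurableTypeE sG; split.
  by move=> mf _ Y mY; rewrite GE; apply: mf; exists Y.
by move=> mf _ [Y mY <-]; rewrite -GE; exact: mf.
Qed.

Lemma measurable_wrtS G H f : G `<=` H ->
  measurable_wrt G f -> measurable_wrt H f.
Proof. by move=> GH /subset_trans; exact. Qed.

Lemma measurable_wrt_fun G f : G `<=` measurable ->
  measurable_wrt G f -> measurable_fun setT f.
Proof. by move=> Gm mf _ Y mY; apply/Gm/mf; exists Y. Qed.

Lemma measurable_wrt_le G f (a : \bar R) : measurable_wrt G f ->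
  G [set w | (f w <= a)%E].
Proof.
move=> mf; have -> : [set w | (f w <= a)%E] = setT `&` f @^-1` [set` `]-oo, a]].
  by rewrite setTI; apply/seteqP; split => w /=; rewrite in_itv.
by apply: mf; exists [set` `]-oo, a]] => //; exact: emeasurable_itv.
Qed.

Lemma measurable_wrt_ge G f (a : \bar R) : measurable_wrt G f ->
  G [set w | (a <= f w)%E].
Proof.
move=> mf; have -> : [set w | (a <= f w)%E] = setT `&` f @^-1` [set` `[a, +oo[].
  by rewrite setTI; apply/seteqP; split => w /=; rewrite in_itv/= andbT.
by apply: mf; exists [set` `[a, +oo[] => //; exact: emeasurable_itv.
Qed.

Lemma sigma_algebra_setC G A : sigma_algebra setT G -> G A -> G (~` A).
Proof. by move=> [_ GC _] /GC; rewrite setTD. Qed.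

Lemma sigma_algebra_setI G A B : sigma_algebra setT G ->
  G A -> G B -> G (A `&` B).
Proof.
move=> /measurable_g_measurableTypeE GE; rewrite -GE.
exact: (@measurableI _ (g_sigma_algebraType G)).
Qed.

Lemma sigma_algebra_setT G : sigma_algebra setT G -> G setT.
Proof. by move=> [G0 GC _]; rewrite -(setD0 setT); exact: GC. Qed.

Lemma measurable_wrt_limn_esup G (f : nat -> Omega -> \bar R) :
  sigma_algebra setT G -> (forall n, measurable_wrt G (f n)) ->
  measurable_wrt G (fun w => limn_esup (f ^~ w)).
Proof.
move=> sG Gf; apply/measurable_wrtP => //.
by apply: measurable_fun_limn_esup => n; apply/measurable_wrtP.
Qed.

Lemma ge0_integral_setID (mu : {measure set Omega -> \bar R}) f
    (A C : set Omega) :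
  measurable A -> measurable C -> measurable_fun setT f ->
  (forall w, 0 <= f w)%E ->
  (\int[mu]_(w in A) f w =
   \int[mu]_(w in A `&` C) f w + \int[mu]_(w in A `\` C) f w)%E.
Proof.
move=> mA mC mf f0; rewrite -ge0_integral_setU// ?setUIDK//.
- exact: measurableI.
- exact: measurableD.
- exact: measurable_funTS.
- by apply/disj_set2P/seteqP; split => // w [[_ Cw] [_ /(_ Cw)]].
Qed.

End SubSigmaAlgebra.

(** * Upcrossings of a path along a finite list of times *)

Section PathUpcrossings.
Context {R : realType} {I : Type}.
Implicit Types (x : I -> \bar R) (a b : R) (k : nat) (s : seq I).

(** Buying at the first price at most [a], selling at the next price at least
    [b], and so on: whether [k] sales take place along [s].  The flag tells
    whether the walk holds the asset and waits for a high price.  The greedy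
    choice makes the event decidable one time at a time, as the estimate of its
    probability requires. *)
Fixpoint upcrosses x a b (waiting : bool) k s : bool :=
  if k is k'.+1 then
    if s is t :: s' then
      if waiting then
        if (b%:E <= x t)%E then upcrosses x a b false k' s'
        else upcrosses x a b true k s'
      else
        if (x t <= a%:E)%E then upcrosses x a b true k s'
        else upcrosses x a b false k s'
    else false
  else true.

Lemma upcrossesW x a b h k s :
  upcrosses x a b h k.+1 s -> upcrosses x a b h k s.
Proof.
elim: s h k => [|t s IH] h [|k]//=.
by case: h; case: ifPn => _; exact: IH.
Qed.

Lemma upcrosses_wait x a b k s : a < b ->
  upcrosses x a b false k s -> upcrosses x a b true k s.
Proof.
move=> ab; elim: s k => [|t s IH] [|k]//=.
case: ifPn => [xa|_].
  by rewrite ifF//; apply/negbTE; rewrite -ltNge (le_lt_trans xa)// lte_fin.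
by case: ifPn => _; [exact: upcrossesW | exact: IH].
Qed.

Lemma upcrosses_cons_low x a b k t s : a < b ->
  upcrosses x a b false k s -> upcrosses x a b false k (t :: s).
Proof.
by move=> ab; case: k => //= k; case: ifPn => // _; exact: upcrosses_wait.
Qed.

Lemma upcrosses_restart x a b k s : a < b ->
  upcrosses x a b true k.+1 s -> upcrosses x a b false k s.
Proof.
move=> ab; elim: s k => // t s IH k; rewrite [X in X -> _]/=.
by case: ifPn => _ => [|/IH]; exact: upcrosses_cons_low.
Qed.

Lemma upcrosses_cons x a b h k t s : a < b ->
  upcrosses x a b h k s -> upcrosses x a b h k (t :: s).
Proof.
move=> ab; case: h; last exact: upcrosses_cons_low.
by case: k => // k /=; case: ifPn => // _; exact: upcrosses_restart.
Qed.

End PathUpcrossings.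

(** The greedy strategy is optimal, so additional times never hurt; the reason
    is that holding the asset is at least as good as not holding it, and at most
    one upcrossing better. *)
Lemma upcrosses_subseq {R : realType} {I : eqType} (x : I -> \bar R) (a b : R)
    h k (s1 s2 : seq I) : a < b -> subseq s1 s2 ->
  upcrosses x a b h k s1 -> upcrosses x a b h k s2.
Proof.
move=> ab; elim: s2 h k s1 => [|t s2 IH] h k [|u s1]//.
  by case: k.
rewrite [subseq _ _]/=; case: eqVneq => [->|_] s12; last first.
  by move=> /(IH _ _ _ s12); exact: upcrosses_cons.
by case: k => //= k; case: h; case: ifPn => _; exact: IH.
Qed.

(** * Dubins' inequality *)

(** The supermartingale inequality is put in integrated form, over the sets of
    the earlier sigma-algebra: nonnegative integrands give both sides a meaning
    in [[0, +oo]], and no conditional expectation has to be chosen. *)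
Definition nonneg_supermartingale {d} {Omega : measurableType d} {R : realType}
    (P : probability Omega R) {disp} {I : porderType disp}
    (F : I -> set_system Omega) (X : I -> Omega -> \bar R) : Prop :=
  [/\ filtration F, forall t, measurable_wrt (F t) (X t),
      forall t w, (0 <= X t w)%E &
      forall s t A, (s <= t)%O -> F s A ->
        (\int[P]_(w in A) X t w <= \int[P]_(w in A) X s w)%E].

Section Dubins.
Context {d : measure_display} {Omega : measurableType d} {R : realType}.
Context (P : probability Omega R).
Context {disp : Order.disp_t} {I : orderType disp}.
Context (F : I -> set_system Omega) (X : I -> Omega -> \bar R).
Hypothesis supX : nonneg_supermartingale P F X.
Context (a b : R) (a0 : 0 < a) (ab : a < b).

Let U h k s := [set w | upcrosses (X^~ w) a b h k s].

Let b0 : 0 < b. Proof. exact: lt_trans ab. Qed.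

Let mX t : measurable_fun setT (X t).
Proof. by case: supX => -[_ Fm _] FX _ _; exact: measurable_wrt_fun (FX t). Qed.

Let mlow t : measurable [set w | (X t w <= a%:E)%E].
Proof.
by case: supX => -[_ Fm _] FX _ _; apply: Fm; exact: measurable_wrt_le (FX t).
Qed.

Let mhigh t : measurable [set w | (b%:E <= X t w)%E].
Proof.
by case: supX => -[_ Fm _] FX _ _; apply: Fm; exact: measurable_wrt_ge (FX t).
Qed.

Lemma measurable_upcrosses h k s : measurable (U h k s).
Proof.
elim: s h k => [|t s IH] h [|k].
- by rewrite (_ : U _ _ _ = setT)//; apply/seteqP; split.
- by rewrite (_ : U _ _ _ = set0)//; apply/seteqP; split.
- by rewrite (_ : U _ _ _ = setT)//; apply/seteqP; split.
- case: h.
  + rewrite (_ : U _ _ _ = ([set w | (b%:E <= X t w)%E] `&` U false k s) `|`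
      (~` [set w | (b%:E <= X t w)%E] `&` U true k.+1 s)).
      by apply: measurableU; apply: measurableI => //; exact: measurableC.
    apply/seteqP; split => w; rewrite /U/=.
      by case: ifPn => [bX ?|/negP bX ?]; [left|right].
    by case=> -[]; [move=> -> | move=> /negP/negbTE ->].
  + rewrite (_ : U _ _ _ = ([set w | (X t w <= a%:E)%E] `&` U true k.+1 s) `|`
      (~` [set w | (X t w <= a%:E)%E] `&` U false k.+1 s)).
      by apply: measurableU; apply: measurableI => //; exact: measurableC.
    apply/seteqP; split => w; rewrite /U/=.
      by case: ifPn => [bX ?|/negP bX ?]; [left|right].
    by case=> -[]; [move=> -> | move=> /negP/negbTE ->].
Qed.

Let mU := measurable_upcrosses.

Local Notation r := (a / b).

Let r0 n : (0 <= (r ^+ n)%:E)%E.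
Proof. by rewrite lee_fin exprn_ge0// divr_ge0// ltW. Qed.

(** One step of the induction below: [C] is the event that the walk changes
    phase at the current time, [V] the event to be bounded, [V1] and [V2] what
    remains of it after a change of phase and without one. *)
Let split_bound (c : R) (E C V V1 V2 : set Omega) (f : Omega -> \bar R) :
  measurable E -> measurable C -> measurable V -> measurable V1 ->
  measurable V2 -> V `&` C `<=` V1 -> V `\` C `<=` V2 ->
  measurable_fun setT f -> (forall w, 0 <= f w)%E -> 0 <= c ->
  (c%:E * P ((E `&` C) `&` V1) <= \int[P]_(w in E `&` C) f w)%E ->
  (c%:E * P ((E `\` C) `&` V2) <= \int[P]_(w in E `\` C) f w)%E ->
  (c%:E * P (E `&` V) <= \int[P]_(w in E) f w)%E.
Proof.
move=> mE mC mV mV1 mV2 VV1 VV2 mf f0 c0 h1 h2.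
have mEC := measurableI _ _ mE mC; have mEDC := measurableD mE mC.
rewrite (ge0_integral_setID _ _ _ C)//.
apply: le_trans (leeD h1 h2).
rewrite -ge0_muleDr// lee_wpmul2l// ?lee_fin//.
apply: le_trans (measureU2 _ _ _); [|exact: measurableI..].
apply: le_measure; rewrite ?inE.
- exact: measurableI.
- by apply: measurableU; exact: measurableI.
- move=> w [Ew Vw]; have [Cw|Cw] := pselect (C w).
    by left; split => //; apply: VV1.
  by right; split => //; apply: VV2.
Qed.

(** Reinvest all the wealth at each purchase.  While the asset is held the
    wealth is a multiple of [X], which is a supermartingale; otherwise it is
    constant; and each upcrossing multiplies it by [b / a] at least.  Having
    [k] upcrossings ahead is therefore worth [(a / b) ^+ k] when the asset is
    not held, and [X t0 * (a / b) ^+ k / b] when it is and [k.+1] are ahead.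
    Both bounds hold on every event [E] known at the current time [t0], which
    lets the induction go through. *)
Lemma upcrosses_bound (s : seq I) k t0 E : F t0 E -> path <=%O t0 s ->
  (P (E `&` U false k s) <= (r ^+ k)%:E * P E)%E /\
  (b%:E * P (E `&` U true k.+1 s) <= (r ^+ k)%:E * \int[P]_(w in E) X t0 w)%E.
Proof.
have [[Fs Fm Finc] FX X0 Xint] := supX.
elim: s k t0 E => [|t s IH] k t0 E FE.
  move=> _; have mE := Fm _ _ FE; split; last first.
    rewrite (_ : U _ _ _ = set0) ?setI0 ?measure0 ?mule0; last first.
      by apply/seteqP; split.
    by rewrite mule_ge0// integral_ge0.
  case: k => [|k].
    by rewrite expr0 mul1e (_ : U _ _ _ = setT) ?setIT//; apply/seteqP; split.
  rewrite (_ : U _ _ _ = set0) ?setI0 ?measure0 ?mule_ge0//.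
  by apply/seteqP; split.
rewrite [path _ _ _]/= => /andP[t0t ts].
have mE := Fm _ _ FE.
have FtE : F t E.
  by move: t0t; rewrite le_eqVlt => /predU1P[<-//|/Finc]; exact.
have Ilow : F t [set w | (X t w <= a%:E)%E] by exact: measurable_wrt_le.
have Ihigh : F t [set w | (b%:E <= X t w)%E] by exact: measurable_wrt_ge.
have FI A : F t A -> F t (E `&` A) by exact: sigma_algebra_setI.
have FD A : F t A -> F t (E `\` A).
  by move=> FA; rewrite setDE; apply: FI; exact: sigma_algebra_setC.
split.
- case: k => [|k].
    by rewrite expr0 mul1e (_ : U _ _ _ = setT) ?setIT//; apply/seteqP; split.
  have [_ hI] := IH k t _ (FI _ Ilow) ts.
  have [hD _] := IH k.+1 t _ (FD _ Ilow) ts.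
  have := @split_bound 1 E _ (U false k.+1 (t :: s)) (U true k.+1 s)
    (U false k.+1 s) (cst (r ^+ k.+1)%:E) mE (mlow t) (measurable_upcrosses _ _ _)
    (measurable_upcrosses _ _ _) (measurable_upcrosses _ _ _).
  rewrite !mul1e !integral_cst//; last 2 first.
  - exact: measurableD.
  - exact: measurableI.
  apply => //.
  + by move=> w [] /= + Xa; rewrite /U/= Xa.
  + by move=> w [] /= + /negP/negbTE Xa; rewrite /U/= Xa.
  + by move=> w; exact: r0.
  (* At a purchase [X t <= a], so [X t * r ^+ k / b] is at most [r ^+ k.+1]. *)
  + rewrite -(@lee_pmul2l _ b%:E)// ?lte_fin//; apply: le_trans hI _.
    rewrite muleA -EFinM exprSr mulrCA [b * _]mulrC divfK ?gt_eqF//.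
    rewrite EFinM -muleA lee_wpmul2l//.
    apply: (@le_trans _ _ (\int[P]_(w in E `&` [set w | (X t w <= a%:E)%E])
      (cst a%:E) w)%E).
      apply: ge0_le_integral => //.
      * exact: measurableI.
      * exact: measurable_funTS.
      * by move=> w [].
    by rewrite integral_cst//; exact: measurableI.
- have h0 : (\int[P]_(w in E) X t w <= \int[P]_(w in E) X t0 w)%E.
    exact: Xint.
  apply: le_trans (lee_wpmul2l (r0 k) h0).
  rewrite -ge0_integralZl//; last exact: measurable_funTS.
  have [hI _] := IH k t _ (FI _ Ihigh) ts.
  have [_ hD] := IH k t _ (FD _ Ihigh) ts.
  apply: (@split_bound b E _ (U true k.+1 (t :: s)) (U false k s)
    (U true k.+1 s) _ mE (mhigh t)) => //.
  + by move=> w [] /= + Xa; rewrite /U/= Xa.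
  + by move=> w [] /= + /negP/negbTE Xa; rewrite /U/= Xa.
  + exact: measurable_funeM.
  + by move=> w; rewrite mule_ge0.
  + exact: ltW.
  + rewrite ge0_integralZl//; [|exact: measurableI|exact: measurable_funTS].
    apply: le_trans (lee_wpmul2l _ hI) _; first by rewrite lee_fin ltW.
    rewrite muleCA lee_wpmul2l// -integral_cst; last exact: measurableI.
    apply: ge0_le_integral => //.
    * exact: measurableI.
    * by move=> w _; rewrite lee_fin ltW.
    * exact: measurable_funTS.
    * by move=> w [].
  + by rewrite ge0_integralZl//; [exact: measurableD|exact: measurable_funTS].
Qed.

(** Dubins' upcrossing inequality, which is uniform in the list of times and
    in the initial value of the process. *)
Lemma dubins k (s : seq I) : sorted <=%O s -> (P (U false k s) <= (r ^+ k)%:E)%E.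
Proof.
have [[Fs _ _] _ _ _] := supX.
case: s => [|t s] ts.
  case: k => [|k]; last first.
    by rewrite (_ : U _ _ _ = set0) ?measure0//; apply/seteqP; split.
  by rewrite expr0 probability_le1.
have /= := @upcrosses_bound (t :: s) k t setT (sigma_algebra_setT _ (Fs t)).
by rewrite lexx => /(_ ts)[+ _]; rewrite setTI probability_setT mule1.
Qed.

End Dubins.

Lemma ae_countable {d} {T : measurableType d} {R : realFieldType}
    (mu : {measure set T -> \bar R}) {J : countType} (Q : J -> T -> Prop) :
  (forall j, {ae mu, forall x, Q j x}) -> {ae mu, forall x, forall j, Q j x}.
Proof.
move=> muQ.
pose N n := if unpickle n is Some j then ~` [set x | Q j x] else set0.
have : mu.-negligible (\bigcup_n N n).
  apply: negligible_bigcup => n; rewrite /N; case: unpickle => [j|//].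
  - exact: muQ.
  - exact: negligible_set0.
apply: negligibleS => x /existsNP[j Qj].
by exists (pickle j) => //; rewrite /N pickleK.
Qed.

(** * Almost every path has boundedly many upcrossings *)

Lemma lt_sorted_subseq {disp} {I : porderType disp} (s1 s2 : seq I) :
  sorted <%O s1 -> sorted <%O s2 -> {subset s1 <= s2} -> subseq s1 s2.
Proof.
move=> so1 so2 s12; suff -> : s1 = [seq t <- s2 | t \in s1] by exact: filter_subseq.
apply: (irr_sorted_eq lt_trans ltxx) => //; first exact: sorted_filter lt_trans _ _ so2.
by move=> t; rewrite mem_filter; case: (boolP (t \in s1)) => //= /s12 ->.
Qed.

Section BoundedUpcrossings.
Context {d : measure_display} {Omega : measurableType d} {R : realType}.
Context (P : probability Omega R).
Context {disp : Order.disp_t} {I : orderType disp}.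

(** The times are restricted to a sequence [q] and the levels to rational
    numbers in order that the exceptional set be a countable union. *)
Definition bounded_upcrossings (q : nat -> I) (x : I -> \bar R) : Prop :=
  forall a b : rat, 0 < a -> a < b -> exists k, forall s : seq I,
    sorted <%O s -> (forall t, t \in s -> range q t) ->
    ~~ upcrosses x (ratr a) (ratr b) false k s.

Context (F : I -> set_system Omega) (X : I -> Omega -> \bar R).
Hypothesis supX : nonneg_supermartingale P F X.
Context (q : nat -> I).

Let D n := undup (sort <=%O [seq q i | i <- iota 0 n]).

Let sorted_D n : sorted <%O (D n).
Proof.
rewrite lt_sorted_uniq_le undup_uniq/=.
by apply: (subseq_sorted le_trans (undup_subseq _)); exact: sort_le_sorted.
Qed.

Let mem_D n t : (t \in D n) = (t \in [seq q i | i <- iota 0 n]).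
Proof. by rewrite mem_undup mem_sort. Qed.

Let in_D (s : seq I) : (forall t, t \in s -> range q t) ->
  exists n, {subset s <= D n}.
Proof.
elim: s => [|t s IH] sq; first by exists 0%N.
have [n sn] := IH (fun u us => sq u (@mem_behead _ (t :: s) u us)).
have [i _ qi] := sq t (mem_head _ _).
exists (maxn i.+1 n) => u; rewrite inE mem_D => /predU1P[->|/sn].
  by rewrite -qi map_f// mem_iota/= add0n leq_maxl.
rewrite mem_D => /mapP[j + ->]; rewrite mem_iota/= add0n => jn.
by rewrite map_f// mem_iota/= add0n leq_max jn orbT.
Qed.

Let upcrosses_ae (a b : R) : 0 < a -> a < b ->
  {ae P, forall w, exists k, forall s : seq I,
    sorted <%O s -> (forall t, t \in s -> range q t) ->
    ~~ upcrosses (X^~ w) a b false k s}.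
Proof.
move=> a0 ab.
pose V k n := [set w | upcrosses (X^~ w) a b false k (D n)].
have mV k n : measurable (V k n) by exact: measurable_upcrosses supX _ _ _ _ _.
have VS k : nondecreasing_seq (V k).
  move=> n m nm; apply/subsetPset => w; apply: upcrosses_subseq => //.
  apply: lt_sorted_subseq => // t; rewrite !mem_D => /mapP[i + ->].
  by rewrite !mem_iota/= !add0n => /leq_trans /(_ nm) im; rewrite map_f// mem_iota.
have PV k : (P (\bigcup_n V k n) <= ((a / b) ^+ k)%:E)%E.
  have mUV : measurable (\bigcup_n V k n) by exact: bigcup_measurable.
  have cV := @nondecreasing_cvg_mu _ _ _ P _ (mV k) mUV (VS k).
  rewrite -(cvg_lim _ cV)//; apply: lime_le; first exact/cvgP/cV.
  apply: nearW => n /=; apply: dubins supX _ _ _ _ _ _ _ => //.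
  exact: sub_sorted (@ltW _ _) _ (sorted_D n).
have mN : measurable (\bigcap_k \bigcup_n V k n).
  by apply: bigcapT_measurable => k; exact: bigcup_measurable.
exists (\bigcap_k \bigcup_n V k n); split => //.
  apply/eqP; rewrite eq_le measure_ge0 andbT.
  apply/lee_addgt0Pr => e e0; rewrite add0e.
  have : ((a / b) ^+ n : R^o) @[n --> \oo] --> (0 : R^o).
    apply: cvg_expr; rewrite ger0_norm ?divr_ge0 ?ltW ?ltr_pdivrMr ?mul1r//;
    exact: lt_trans ab.
  move=> /cvgrPdist_lt/(_ _ e0)[n _ /(_ n (leqnn n))]/=.
  rewrite sub0r normrN => /(le_lt_trans (ler_norm _)) ne.
  apply: (@le_trans _ _ ((a / b) ^+ n)%:E); last by rewrite lee_fin ltW.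
  apply: le_trans (PV n); apply: le_measure; rewrite ?inE//.
    exact: bigcup_measurable.
  by move=> w Nw; exact: Nw.
move=> w /= Nw k _; have /existsNP[s] := fun h => Nw (ex_intro _ k h).
move=> /not_implyP[so /not_implyP[sq /negP]]; rewrite negbK => us.
have [n sn] := in_D _ sq; exists n => //.
by apply: upcrosses_subseq us => //; exact: lt_sorted_subseq.
Qed.

(** For fixed levels, the event that some list of sampled times has [k]
    upcrossings is the increasing union over the lists [D n], so Dubins'
    inequality passes to it; the bound tends to [0] as [k] grows. *)
Lemma bounded_upcrossings_ae : {ae P, forall w, bounded_upcrossings q (X^~ w)}.
Proof.
have : {ae P, forall w, forall ab : rat * rat, 0 < ab.1 -> ab.1 < ab.2 ->
    exists k, forall s : seq I, sorted <%O s -> (forall t, t \in s -> range q t) ->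
    ~~ upcrosses (X^~ w) (ratr ab.1) (ratr ab.2) false k s}.
  apply: ae_countable => -[a b].
  have [a0|a0] := boolP (0 < a); last by apply: aeW => w.
  have [ab|ab] := boolP (a < b); last by apply: aeW => w.
  have : 0 < ratr a :> R by rewrite ltr0q.
  move=> /(upcrosses_ae _ (ratr b)); rewrite ltr_rat => /(_ ab).
  by apply: filterS => w Xw _ _.
by apply: filterS => w Xw a b; exact: (Xw (a, b)).
Qed.

End BoundedUpcrossings.

(** * From bounded upcrossings to limits *)

Section ERealConvergence.
Context {R : realType} {T : Type} {G : set_system T} {FG : Filter G}.
Implicit Types g : T -> \bar R.

Lemma ereal_cvg_rays g (l : \bar R) :
  (forall c : R, (c%:E < l)%E -> \forall t \near G, (c%:E <= g t)%E) ->
  (forall c : R, (l < c%:E)%E -> \forall t \near G, (g t <= c%:E)%E) ->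
  g t @[t --> G] --> l.
Proof.
case: l => [r||] gl gu.
- move=> A [e /= e0 rA].
  have e2 : 0 < e / 2 by rewrite divr_gt0.
  have hl : \forall t \near G, ((r - e / 2)%:E <= g t)%E.
    by apply: gl; rewrite lte_fin ltrBlDr ltrDl.
  have hu : \forall t \near G, (g t <= (r + e / 2)%:E)%E.
    by apply: gu; rewrite lte_fin ltrDl.
  apply: filterS2 hl hu => t /=; case: (g t) => // y; rewrite !lee_fin => ly yu.
  apply: rA => /=; rewrite ltr_norml; apply/andP; split; lra.
- by apply/cvgeyPge => c; apply: gl; rewrite ltry.
- by apply/cvgeNyPle => c; apply: gu; rewrite ltNyr.
Qed.

Lemma ereal_cvg_ge_near g (l c : \bar R) : g t @[t --> G] --> l ->
  (c < l)%E -> \forall t \near G, (c <= g t)%E.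
Proof.
move=> gl cl.
have : \forall t \near G, (c < g t)%E.
  exact: (gl _ (open_nbhs_nbhs (conj (@open_ereal_gt_ereal _ c) cl))).
by apply: filterS => t /ltW.
Qed.

Lemma ereal_cvg_le_near g (l c : \bar R) : g t @[t --> G] --> l ->
  (l < c)%E -> \forall t \near G, (g t <= c)%E.
Proof.
move=> gl lc.
have : \forall t \near G, (g t < c)%E.
  exact: (gl _ (open_nbhs_nbhs (conj (@open_ereal_lt_ereal _ c) lc))).
by apply: filterS => t /ltW.
Qed.

(** A function without oscillation converges, its limit being the supremum of
    the levels above which it finally stays: a larger level that it did not
    finally stay below would leave room for two rational levels between which
    it oscillates. *)
Lemma ereal_settled_cvg g : (forall t, (0 <= g t)%E) ->
  (forall a b : rat, 0 < a -> a < b ->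
    (\forall t \near G, ((ratr a)%:E <= g t)%E) \/
    (\forall t \near G, (g t <= (ratr b)%:E)%E)) ->
  exists l : \bar R, g t @[t --> G] --> l.
Proof.
move=> g0 gab.
pose S := [set c : \bar R | \forall t \near G, (c <= g t)%E].
have S0 : S 0%E by apply: filterE.
exists (ereal_sup S); apply: ereal_cvg_rays => c.
- move=> /ereal_sup_gt[e Se ce]; apply: filterS Se => t; apply: le_trans.
  exact: ltW.
- move=> lc; have l0 : (0 <= ereal_sup S)%E by exact: ereal_sup_ubound.
  move: (lc) l0; case El : (ereal_sup S) => [l||]//.
  rewrite lte_fin lee_fin => lc' l0.
  have [b /andP[lb bc]] : exists b : rat, l < ratr b < c.
    by have [b] := rat_in_itvoo lc'; rewrite in_itv/= => ?; exists b.
  have [a /andP[la ab]] : exists a : rat, (l < ratr a) && (ratr a < ratr b :> R).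
    by have [a] := rat_in_itvoo lb; rewrite in_itv/= => ?; exists a.
  have a0 : 0 < a by rewrite -(ltr0q R) (le_lt_trans l0).
  have ab' : a < b by rewrite -(ltr_rat R).
  have [Sa|] := gab a b a0 ab'.
    have : ((ratr a)%:E <= ereal_sup S)%E by exact: ereal_sup_ubound.
    by rewrite El lee_fin leNgt la.
  by apply: filterS => t /le_trans; apply; rewrite lee_fin ltW.
Qed.

End ERealConvergence.

Section Filters.
Context {disp : Order.disp_t} {I : orderType disp}.
Implicit Types (q : nat -> I) (t : I).

(** Limits at infinity, and from the right at [t], along the times [q n]
    only. *)
Definition sampled_infty q : set_system I :=
  filter_from setT (fun t0 => [set t | range q t /\ (t0 < t)%O]).

Definition sampled_right q t : set_system I :=
  filter_from [set u | (t < u)%O] (fun u => [set v | range q v /\ (t < v < u)%O]).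

Lemma sampled_infty_window q t0 :
  sampled_infty q [set t | range q t /\ (t0 < t)%O].
Proof. by exists t0. Qed.

Lemma sampled_right_window q t u : (t < u)%O ->
  sampled_right q t [set v | range q v /\ (t < v < u)%O].
Proof. by exists u. Qed.

Global Instance sampled_infty_filter q : Filter (sampled_infty q).
Proof.
apply: filter_from_filter; first by exists (q 0%N).
move=> s t _ _; exists (Order.max s t) => // u [qu].
by rewrite gt_max => /andP[su tu].
Qed.

Lemma sampled_right_filter q t u : (t < u)%O -> Filter (sampled_right q t).
Proof.
move=> tu; apply: filter_from_filter; first by exists u.
move=> v w tv tw; exists (Order.min v w); first by rewrite /= lt_min tv.
by move=> z [qz] /andP[tz]; rewrite lt_min => /andP[zv zw]; split; split => //;
  rewrite tz.
Qed.

End Filters.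

Section PathLimits.
Context {R : realType} {disp : Order.disp_t} {I : orderType disp}.
Context (q : nat -> I) (x : I -> \bar R).
Hypotheses (x0 : forall t, (0 <= x t)%E) (xq : bounded_upcrossings q x).

Let upcrosses2 (a b : R) k u v s : (x u <= a%:E)%E -> (b%:E <= x v)%E ->
  upcrosses x a b false k s -> upcrosses x a b false k.+1 [:: u, v & s].
Proof. by move=> xu xv; rewrite /= xu xv. Qed.

Let not_settled {G : set_system I} {FG : Filter G} (a b : rat) : 
  ~ ((\forall t \near G, ((ratr a)%:E <= x t)%E) \/
     (\forall t \near G, (x t <= (ratr b)%:E)%E)) ->
  forall A, G A -> (exists2 t, A t & (x t <= (ratr a)%:E)%E) /\
                   (exists2 t, A t & ((ratr b)%:E <= x t)%E).
Proof.
move=> /not_orP[na nb] A GA; split.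
  apply: contrapT => /forall2NP h; apply: na; apply: filterS GA => t At.
  by have [//|/negP] := h t; rewrite -ltNge => /ltW.
apply: contrapT => /forall2NP h; apply: nb; apply: filterS GA => t At.
by have [//|/negP] := h t; rewrite -ltNge => /ltW.
Qed.

(** A path that oscillates between two levels has lists of times with any
    number of upcrossings: each upcrossing can be followed by others later on,
    arbitrarily far. *)
Lemma cvg_sampled_infty : exists l : \bar R, x t @[t --> sampled_infty q] --> l.
Proof.
apply: ereal_settled_cvg => // a b a0 ab.
apply: contrapT => /not_settled osc.
have [k xk] := xq a b a0 ab.
suff [s [so sq _ us]] : exists s, [/\ sorted <%O s, forall t, t \in s -> range q t,
    forall t, t \in s -> (q 0%N < t)%O & upcrosses x (ratr a) (ratr b) false k s].
  by have := xk s so sq; rewrite us.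
elim: k (q 0%N) {xk} => [|k IH] t0; first by exists [::].
have [[u [qu t0u] xu] _] : _ /\ _ := osc _ (sampled_infty_window q t0).
have [_ [v [qv uv] xv]] : _ /\ _ := osc _ (sampled_infty_window q u).
have [s [so sq vs us]] := IH v.
exists [:: u, v & s]; split; last exact: upcrosses2.
- by rewrite /= uv/= path_sortedE; [rewrite so andbT; exact/allP|exact: lt_trans].
- by move=> t; rewrite !inE => /or3P[/eqP->|/eqP->|/sq].
- move=> t; rewrite !inE => /or3P[/eqP->//|/eqP->|/vs vt]; first exact: lt_trans uv.
  exact: lt_trans (lt_trans t0u uv) vt.
Qed.

(** Oscillation from the right at [t] is refuted likewise, except that new
    upcrossings are found before the earlier ones, nearer to [t]. *)
Lemma cvg_sampled_right t u : (t < u)%O ->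
  exists l : \bar R, x v @[v --> sampled_right q t] --> l.
Proof.
move=> tu; have FG := sampled_right_filter q _ _ tu.
apply: ereal_settled_cvg => // a b a0 ab.
apply: contrapT => /not_settled osc.
have [k xk] := xq a b a0 ab.
suff [s [so sq _ us]] : exists s, [/\ sorted <%O s, forall v, v \in s -> range q v,
    forall v, v \in s -> (t < v)%O & upcrosses x (ratr a) (ratr b) false k s].
  by have := xk s so sq; rewrite us.
elim: k {xk} => [|k [s [so sq ts us]]]; first by exists [::].
have th : (t < head u s)%O by case: s ts {so sq us} => //= v s ts; exact/ts/mem_head.
have [_ [w [qw /andP[tw wh]] xw]] : _ /\ _ :=
  osc _ (sampled_right_window q _ _ th).
have [[v [qv /andP[tv vw]] xv] _] : _ /\ _ :=
  osc _ (sampled_right_window q _ _ tw).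
exists [:: v, w & s]; split; last exact: upcrosses2.
- by case: s so wh {sq ts us th} => [|z s] /=; rewrite vw //= => -> ->.
- by move=> z; rewrite !inE => /or3P[/eqP->|/eqP->|/sq].
- by move=> z; rewrite !inE => /or3P[/eqP->|/eqP->|/ts].
Qed.

End PathLimits.

(** * Reciprocals and limits of random variables *)

Lemma measurable_inve {R : realType} :
  measurable_fun setT (fun x : \bar R => (x^-1)%E).
Proof.
have mV : measurable_fun setT (fun r : R => r^-1).
  have -> : [set: R] = [set 0] `|` ~` [set 0] by rewrite setUv.
  apply/measurable_funU => //; first exact: measurableC.
  split; first exact: measurable_fun_set1.
  apply: open_continuous_measurable_fun.
    by apply: closed_openC; exact: accessible_closed_set1 (hausdorff_accessible (@norm_hausdorff _ _)) _.
  by move=> r; rewrite inE /= => /eqP r0; exact: inv_continuous.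
have -> : (fun x : \bar R => (x^-1)%E) = (fun x =>
    if x == 0%E then +oo%E else if x == -oo%E then -oo%E else ((fine x)^-1)%:E).
  apply/funext => x; case: (inveP x) => [||//|r r0]; rewrite ?eqxx//=.
    by rewrite invr0.
  by rewrite eqe (negbTE r0).
have m1 (y : \bar R) : measurable_fun setT (fun x : \bar R => x == y).
  apply: (measurable_fun_bool true) => //.
  rewrite setTI (_ : _ @^-1` _ = [set y]); first exact: emeasurable_set1.
  by apply/seteqP; split => x /= /eqP.
apply: measurable_fun_ifT => //; apply: measurable_fun_ifT => //.
by apply/measurable_EFinP/measurableT_comp => //; exact: fine_measurable.
Qed.

Lemma limn_esup_le {R : realType} (u : (\bar R)^nat) c :
  (forall n, (u n <= c)%E) -> (limn_esup u <= c)%E.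
Proof.
move=> uc; rewrite limn_esup_lim; apply: lime_le; first exact: is_cvg_esups.
by apply: nearW => n; apply: ge_ereal_sup => _ [k _ <-].
Qed.

Lemma limn_einf_ge {R : realType} (u : (\bar R)^nat) c :
  (forall n, (c <= u n)%E) -> (c <= limn_einf u)%E.
Proof.
move=> uc; rewrite /limn_einf leeNr; apply: limn_esup_le => n.
by rewrite leeN2.
Qed.

Section LimitVariables.
Context {d : measure_display} {Omega : measurableType d} {R : realType}.
Context (P : probability Omega R).

Lemma fatou_ae (X : nat -> Omega -> \bar R) (Z : Omega -> \bar R) A c :
  measurable A ->
  (forall n, measurable_fun setT (X n)) -> measurable_fun setT Z ->
  (forall n w, 0 <= X n w)%E -> (forall w, 0 <= Z w)%E ->
  {ae P, forall w, X n w @[n --> \oo] --> Z w} ->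
  (forall n, \int[P]_(w in A) X n w <= c)%E -> (\int[P]_(w in A) Z w <= c)%E.
Proof.
move=> mA mX mZ X0 Z0 XZ Xc.
apply: le_trans (le_trans (limn_einf_sup _) (limn_esup_le _ _ Xc)).
apply: le_trans (fatou P mA (fun n => measurable_funTS (mX n)) (fun n w _ => X0 n w)).
apply: ae_ge0_le_integral => //.
- exact: measurable_funTS.
- by move=> w _; exact: limn_einf_ge.
- apply/measurable_funTS/(measurableT_comp (@oppe_measurable R setT)).
  apply: measurable_fun_limn_esup => n.
  exact: measurableT_comp (@oppe_measurable R setT) (mX n).
- by apply: filterS XZ => w Xw _; rewrite (cvg_limn_einf_sup Xw).1.
Qed.

(** The sequence [e] of times reduces the statement, whatever the index set, to
    sequences: the upper limit along [e] is a measurable version of the limit,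
    and Fatou's lemma along [e] bounds the expectation of every version. *)
Lemma cvg_limit_gives_bayes_factor {disp} {I : porderType disp}
    (Phi : set_system I) (e : nat -> I) (X : I -> Omega -> \bar R) :
  e n @[n --> \oo] `=>` Phi ->
  (forall t, measurable_fun setT (X t)) -> (forall t w, 0 <= X t w)%E ->
  (forall t, \int[P]_w X t w <= 1)%E -> converges_ae P Phi X ->
  limit_gives_bayes_factor P Phi X.
Proof.
move=> ePhi mX X0 X1 cX.
have cvge w (l : \bar R) : X t w @[t --> Phi] --> l -> X (e n) w @[n --> \oo] --> l.
  by move=> Xl A Al; exact: (ePhi _ (Xl A Al)).
split => //.
  exists (fun w => limn_esup (fun n => X (e n) w)); split.
  - exact: measurable_fun_limn_esup.
  - by move=> w; exact: limf_esup_ge0.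
  - apply: filterS cX => w [l Xl].
    by rewrite (cvg_limn_einf_sup (cvge _ _ Xl)).2.
move=> Xoo [mXoo Xoo0 XXoo]; split.
- exact: measurableT_comp measurable_inve mXoo.
- by move=> w; rewrite inve_ge0.
- under eq_integral do rewrite inveK.
  apply: (@fatou_ae (X \o e)) => //=.
  by apply: filterS XXoo => w; exact: cvge.
Qed.

Lemma supermartingale_nonneg {disp} {I : porderType disp}
    (F : I -> set_system Omega) (X : I -> Omega -> \bar R) :
  supermartingale P F X -> (forall t w, 0 <= X t w)%E ->
  nonneg_supermartingale P F X.
Proof.
move=> [[Fs Fm Finc] aX sX] X0; split => // [t|s t A].
  by have [] := aX t.
rewrite le_eqVlt => /predU1P[->//|st] FA.
have [Y [[FY iY YX] YXs]] := sX s t st.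
have mA := Fm _ _ FA.
have mXs : measurable_fun setT (X s) by exact: measurable_int (aX s).2.
have mY := measurable_int _ iY.
rewrite -YX//; apply: (@le_trans _ _ (\int[P]_(w in A) (Y^\+)%E w)%E).
  apply: le_integral => //.
  - exact: integrableS iY.
  - by apply: (integrableS measurableT) => //; exact: integrable_funepos.
  - by move=> w _; rewrite funeposE le_max lexx.
apply: ae_ge0_le_integral => //.
- by apply: measurable_funTS; exact: measurable_funepos.
- exact: measurable_funTS.
- by apply: filterS YXs => w YXw _; rewrite funeposE ge_max YXw X0.
Qed.

End LimitVariables.

(** * Continuous time *)

Section ContinuousTime.
Context {R : realType}.
Local Notation T := {nonneg R}.

(** The absolute value makes a time out of every rational number, at the price
    of listing most times twice. *)
Definition rational_time (n : nat) : T :=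
  `|ratr (odflt 0 (unpickle n : option rat)) : R|%:nng.

Lemma nonneg_norm (t : T) : `|t%:num|%:nng = t.
Proof. by apply: val_inj => /=; rewrite ger0_norm. Qed.

Lemma rational_time_dense (s t : T) : (s < t)%O ->
  exists n, (s < rational_time n < t)%O.
Proof.
move=> st; have [a] := @rat_in_itvoo R s%:num t%:num st.
rewrite in_itv/= => /andP[sa at'].
exists (pickle a); rewrite /rational_time pickleK/=.
rewrite -[s]nonneg_norm -[t]nonneg_norm.
apply/andP; split; rewrite -[(_ < _)%O]/(_ < _ :> R)/= ?ger0_norm//;
exact: le_trans (ltW sa).
Qed.

Lemma nonneg_gt (t : T) : (t < (t%:num + 1)%:nng)%O.
Proof. by rewrite -[(_ < _)%O]/(_ < _ :> R)/= ltrDl. Qed.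

Global Instance sampled_right_rational_filter (t : T) :
  ProperFilter (sampled_right rational_time t).
Proof.
have FG := sampled_right_filter rational_time _ _ (nonneg_gt t).
split => // -[u /= tu h].
have [n /andP[tn nu]] := rational_time_dense _ _ tu.
by apply: (h (rational_time n)); split; [exists n|rewrite tn].
Qed.

Implicit Types x : T -> \bar R.

Lemma right_continuous_sampled x (t : T) (l : \bar R) :
  x `|s|%:nng @[s --> t%:num^'+] --> l ->
  x v @[v --> sampled_right rational_time t] --> l.
Proof.
move=> xt A /xt[e /= e0 eA].
have e0' : 0 <= e by exact: ltW.
exists (t%:num + (NngNum e0')%:num)%:nng.
  by rewrite /= -[(_ < _)%O]/(_ < _ :> R)/= ltrDl.
move=> v [_ /andP[tv]]; rewrite -[(_ < _)%O]/(_ < _ :> R)/= => ve.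
rewrite /= -[v]nonneg_norm; apply: eA => //=.
by rewrite distrC gtr0_norm ?subr_gt0// ltrBlDl.
Qed.

(** The right limits of [y] along rational times form a right-continuous
    function: a closed condition that [y] satisfies at all rational times of an
    interval [(t, u)] passes to these limits at all points of the interval. *)
Lemma sampled_right_continuous x y (t : T) :
  (forall s, y v @[v --> sampled_right rational_time s] --> x s) ->
  x `|s|%:nng @[s --> t%:num^'+] --> x t.
Proof.
move=> yx.
have transfer (Q : set (\bar R)) : closed Q ->
    (\forall v \near sampled_right rational_time t, Q (y v)) ->
    \forall s \near t%:num^'+, Q (x `|s|%:nng).
  move=> cQ [u /= tu Qu].
  near=> s.
  have s0 : 0 <= s by apply: (@le_trans _ _ t%:num) => //; near: s; exact: nbhs_right_ge.
  have -> : `|s|%:nng = NngNum s0 by apply: val_inj; rewrite /= ger0_norm.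
  have su : (NngNum s0 < u)%O.
    by rewrite -[(_ < _)%O]/(s < u%:num); near: s; exact: nbhs_right_lt.
  have ts : (t < NngNum s0)%O.
    by rewrite -[(_ < _)%O]/(t%:num < s); near: s; exact: nbhs_right_gt.
  apply: (closed_cvg Q cQ _ _ (yx (NngNum s0))).
  exists u => //= v [qv /andP[sv vu]]; apply: Qu; split => //.
  by rewrite vu (lt_trans ts sv).
apply: ereal_cvg_rays => c lc.
- apply: (transfer [set z | (c%:E <= z)%E]); first exact: closed_ereal_le_ereal.
  exact: ereal_cvg_ge_near (yx t) lc.
- apply: (transfer [set z | (z <= c%:E)%E]); first exact: closed_ereal_ge_ereal.
  exact: ereal_cvg_le_near (yx t) lc.
Unshelve. all: by end_near. Qed.

(** By right-continuity, a closed condition satisfied at all large rational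
    times is satisfied at all large times. *)
Lemma sampled_infty_continuous x (l : \bar R) :
  (forall t, x `|s|%:nng @[s --> t%:num^'+] --> x t) ->
  x t @[t --> sampled_infty rational_time] --> l ->
  x t @[t --> infty_continuous] --> l.
Proof.
move=> xr xl.
have transfer (Q : set (\bar R)) : closed Q ->
    (\forall v \near sampled_infty rational_time, Q (x v)) ->
    \forall s \near infty_continuous, Q (x s).
  move=> cQ [u /= _ Qu].
  rewrite /infty_continuous /nbhs /=; exists u%:num; split => // s us.
  apply: (closed_cvg Q cQ _ _ (right_continuous_sampled _ _ _ (xr `|s|%:nng))).
  exists (`|s| + 1)%:nng; first exact: nonneg_gt.
  move=> v [qv /andP[sv _]]; apply: Qu; split => //; apply: lt_trans sv.
  by rewrite -[(_ < _)%O]/(u%:num < `|s|); exact: lt_le_trans (ler_norm _).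
have FI : Filter (@infty_continuous R) by exact: fmap_filter.
apply: ereal_cvg_rays => c lc.
- apply: (transfer [set z | (c%:E <= z)%E]); first exact: closed_ereal_le_ereal.
  exact: ereal_cvg_ge_near xl lc.
- apply: (transfer [set z | (z <= c%:E)%E]); first exact: closed_ereal_ge_ereal.
  exact: ereal_cvg_le_near xl lc.
Qed.

End ContinuousTime.

(** * Doob's convergence theorem and limits as Bayes factors *)

Section DoobConvergence.
Context {d : measure_display} {Omega : measurableType d} {R : realType}.
Context (P : probability Omega R).

Lemma doob_discrete (F : nat -> set_system Omega) (X : nat -> Omega -> \bar R) :
  nonneg_supermartingale P F X -> converges_ae P \oo X.
Proof.
move=> sX; have [_ _ X0 _] := sX.
apply: filterS (bounded_upcrossings_ae P F X sX id) => w.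
move=> /(cvg_sampled_infty _ _ (X0 ^~ w))[l Xl]; exists l.
apply: cvg_trans Xl => A [n _ nA]; exists n.+1 => // m nm.
by apply: nA; split => //; exists m.
Qed.

Lemma doob_continuous (F : {nonneg R} -> set_system Omega)
    (X : {nonneg R} -> Omega -> \bar R) :
  nonneg_supermartingale P F X -> right_continuous_paths P X ->
  converges_ae P infty_continuous X.
Proof.
move=> sX; have [_ _ X0 _] := sX.
have := bounded_upcrossings_ae P F X sX rational_time.
apply: filterS2 => w /(cvg_sampled_infty _ _ (X0 ^~ w))[l Xl] Xr.
by exists l; exact: sampled_infty_continuous.
Qed.

Lemma nat_times_infty :
  (`|n%:R : R|%:nng : {nonneg R}) @[n --> \oo] `=>` infty_continuous.
Proof.
move=> A [M [_ MA]]; have := nbhs_infty_gtr M.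
by apply: filterS => n; exact: MA.
Qed.

Lemma test_supermartingale_le1 {disp} {I : porderType disp} (t0 : I)
    (F : I -> set_system Omega) (X : I -> Omega -> \bar R) :
  (forall t, (t0 <= t)%O) -> test_supermartingale_from P t0 F X ->
  nonneg_supermartingale P F X /\ forall t, (\int[P]_w X t w <= 1)%E.
Proof.
move=> t0min [supX X0 X1]; have sX := supermartingale_nonneg P F X supX X0.
split => // t; apply: le_trans X1; have [[Fs _ _] _ _ +] := sX.
by apply => //; exact: sigma_algebra_setT.
Qed.

Theorem test_supermartingale_discrete_bayes_factor
    (F : nat -> set_system Omega) (X : nat -> Omega -> \bar R) :
  test_supermartingale_discrete P F X -> limit_gives_bayes_factor P \oo X.
Proof.
move=> tX; have [sX X1] := test_supermartingale_le1 _ _ _ leq0n tX.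
have [[_ Fm _] FX X0 _] := sX.
apply: (@cvg_limit_gives_bayes_factor _ _ _ _ _ _ _ id) => //.
- by move=> t; exact: measurable_wrt_fun (FX t).
- exact: doob_discrete sX.
Qed.

Theorem test_supermartingale_continuous_bayes_factor
    (F : {nonneg R} -> set_system Omega) (X : {nonneg R} -> Omega -> \bar R) :
  test_supermartingale_continuous P F X ->
  limit_gives_bayes_factor P infty_continuous X.
Proof.
move=> [tX Xr _].
have t0min (t : {nonneg R}) : (0%:nng <= t)%O by rewrite -[(_ <= _)%O]/(0 <= t%:num).
have [sX X1] := test_supermartingale_le1 _ _ _ t0min tX.
have [[_ Fm _] FX X0 _] := sX.
apply: cvg_limit_gives_bayes_factor nat_times_infty _ _ _ _ => //.
- by move=> t; exact: measurable_wrt_fun (FX t).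
- exact: doob_continuous sX Xr.
Qed.

End DoobConvergence.

(** * Conditional expectations *)

Section ConditionalExpectation.
Context {d : measure_display} {Omega : measurableType d} {R : realType}.
Context (P : probability Omega R).
Implicit Types (G : set_system Omega) (Z Y : Omega -> \bar R).

(** The identity to a copy of [Omega] whose measurable sets are those of [G]:
    the distribution of this map is the restriction of [P] to [G]. *)
Lemma measurable_coarsening G : <<s G >> `<=` measurable ->
  measurable_fun setT (id : Omega -> g_sigma_algebraType G).
Proof. by move=> Gm _ A GA; rewrite setTI preimage_id; exact: Gm. Qed.

Definition coarsening G (Gm : <<s G >> `<=` measurable) :
    {mfun Omega >-> g_sigma_algebraType G} :=
  HB.pack (id : Omega -> g_sigma_algebraType G)
    (isMeasurableFun.Build _ _ _ _ _ (measurable_coarsening G Gm)).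

Lemma ge0_integral_coarsening G (Gm : <<s G >> `<=` measurable)
    (f : g_sigma_algebraType G -> \bar R) A :
  <<s G >> A -> measurable_fun setT f -> (forall w, 0 <= f w)%E ->
  (\int[distribution P (coarsening G Gm)]_(w in A) f w =
   \int[P]_(w in (A : set Omega)) f w)%E.
Proof.
by move=> GA mf f0; rewrite ge0_integral_pushforward//; exact: measurable_funTS.
Qed.

(** The conditional expectation is the Radon-Nikodym derivative, for the
    restriction of [P] to [G], of the measure with density [Z]. *)
Lemma cond_exp_exists G Z : sigma_algebra setT G -> G `<=` measurable ->
  P.-integrable setT Z -> (forall w, 0 <= Z w)%E ->
  exists Y, is_cond_exp P G Z Y /\ forall w, (0 <= Y w)%E.
Proof.
move=> sG Gm iZ Z0.
pose GT := g_sigma_algebraType G.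
have GE : <<s G >> = G := sigma_algebra_id sG.
have Gsm : <<s G >> `<=` measurable by rewrite GE.
have mZ := measurable_int _ iZ.
pose nu (A : set GT) : \bar R := (\int[P]_(w in (A : set Omega)) Z w)%E.
have nu0 : nu set0 = 0%E by rewrite /nu integral_set0.
have nu_ge0 A : (0 <= nu A)%E by exact: integral_ge0.
have nu_add : semi_sigma_additive nu.
  move=> A mA tA mUA; apply: (semi_sigma_additive_nng_induced mZ Z0) => //.
  - by move=> i; apply: Gsm; exact: mA.
  - by apply: Gsm; exact: mUA.
have nu_fin : fin_num_fun nu.
  move=> A mA; apply: integrable_fin_num; first exact: Gsm.
  by apply: integrableS iZ => //; exact: Gsm.
pose nuM0 : {measure set GT -> \bar R} := HB.pack nu
  (isMeasure.Build _ _ _ nu nu0 nu_ge0 nu_add).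
pose nuM : {finite_measure set GT -> \bar R} := HB.pack nu nuM0
  (Measure_isFinite.Build _ _ _ nuM0 nu_fin).
have nuPG : nuM `<< distribution P (coarsening G Gsm).
  apply/null_content_dominatesP => A mA PA; apply: null_set_integral => //.
  - exact: (Gsm _ mA).
  - exact: measurable_funTS.
have [Y [Y0 _ iY YE]] := radon_nikodym_sigma_finite nuPG.
have mY := measurable_int _ iY.
have mYO : measurable_wrt G Y by apply/measurable_wrtP.
have YE' A : G A -> (\int[P]_(w in A) Y w = \int[P]_(w in A) Z w)%E.
  rewrite -{1}GE => mA; rewrite -[RHS]/(nuM A) YE//.
  by rewrite ge0_integral_coarsening.
exists Y; split => //; split => //.
apply/integrableP; split; first exact: measurable_wrt_fun mYO.
under eq_integral do rewrite gee0_abs//.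
rewrite YE'; last exact: sigma_algebra_setT.
move/integrableP : iZ => [_]; under eq_integral do rewrite gee0_abs//.
by [].
Qed.

(** Variables that are measurable for [G] are compared in the coarsened space,
    where the sets of [G] are all the measurable sets. *)
Lemma sub_integral_ae_eq G (f g : Omega -> \bar R) :
  <<s G >> `<=` measurable ->
  measurable_wrt <<s G >> f -> measurable_wrt <<s G >> g ->
  (forall w, 0 <= f w)%E -> (forall w, 0 <= g w)%E -> P.-integrable setT f ->
  (forall A, <<s G >> A -> \int[P]_(w in A) f w = \int[P]_(w in A) g w)%E ->
  {ae P, forall w, f w = g w}.
Proof.
move=> Gm Gf Gg f0 g0 intf fg; pose GT := g_sigma_algebraType G.
have mwrt (h : Omega -> \bar R) : measurable_wrt <<s G >> h ->
    measurable_fun [set: GT] h.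
  by move=> Gh _ Y mY; apply: Gh; exists Y.
have mf := mwrt _ Gf; have mg := mwrt _ Gg.
have iGf : (distribution P (coarsening G Gm)).-integrable [set: GT] f.
  apply/integrableP; split => //; under eq_integral do rewrite gee0_abs//.
  rewrite ge0_integral_coarsening//; last exact: (@measurableT _ GT).
  by move/integrableP : intf => [_]; under eq_integral do rewrite gee0_abs//.
have [|N [mN PN Nfg]] := integral_ae_eq (@measurableT _ GT) iGf mg.
  by move=> E _ GE; rewrite !ge0_integral_coarsening// fg.
exists N; split; [exact: (Gm _ mN)|exact: PN|].
by apply: subset_trans Nfg => w /= fgw h; exact/fgw/h.
Qed.

(** Conditional Jensen for the concave truncation at [c].  It suffices to
    integrate over the part of [A] where [Y <= c], on which [mine Y c] is [Y]
    and has the same integral as [Z], and over the part where [mine Y c] is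
    [c]. *)
Lemma cond_exp_min G Z Y (c : R) A : sigma_algebra setT G -> G `<=` measurable ->
  measurable_wrt G Y -> measurable_fun setT Z ->
  (forall w, 0 <= Y w)%E -> (forall w, 0 <= Z w)%E -> 0 <= c ->
  (forall A, G A -> \int[P]_(w in A) Y w = \int[P]_(w in A) Z w)%E -> G A ->
  (\int[P]_(w in A) mine (Z w) c%:E <= \int[P]_(w in A) mine (Y w) c%:E)%E.
Proof.
move=> sG Gm GY mZ Y0 Z0 c0 YZ GA.
have mY := measurable_wrt_fun _ _ Gm GY.
pose C := [set w | (Y w <= c%:E)%E].
have GC : G C by exact: measurable_wrt_le.
have GAC := sigma_algebra_setI _ _ _ sG GA GC.
have GADC : G (A `\` C).
  by rewrite setDE; apply: sigma_algebra_setI => //; exact: sigma_algebra_setC.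
have mmin (f : Omega -> \bar R) : measurable_fun setT f ->
    measurable_fun setT (fun w => mine (f w) c%:E).
  by move=> mf; exact: measurable_mine.
have min0 (f : Omega -> \bar R) : (forall w, 0 <= f w)%E ->
    forall w, (0 <= mine (f w) c%:E)%E.
  by move=> f0 w; rewrite le_min f0 lee_fin.
have mA := Gm _ GA; have mC := Gm _ GC.
rewrite (ge0_integral_setID _ _ _ C)//; [|exact: mmin|exact: min0].
rewrite [leRHS](ge0_integral_setID _ _ _ C)//; [|exact: mmin|exact: min0].
apply: leeD.
- rewrite [leRHS](_ : _ = \int[P]_(w in A `&` C) Z w)%E; last first.
    by rewrite -YZ//; apply: eq_integral => w /[!inE] -[_ Yc]; rewrite min_l.
  apply: ge0_le_integral => //.
  + exact: Gm.
  + by move=> w _; exact: min0.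
  + by apply: measurable_funTS; exact: mmin.
  + exact: measurable_funTS.
  + by move=> w _; rewrite ge_min lexx.
- apply: ge0_le_integral => //.
  + exact: Gm.
  + by move=> w _; exact: min0.
  + by apply: measurable_funTS; exact: mmin.
  + by apply: measurable_funTS; exact: mmin.
  + move=> w [_ /negP]; rewrite -ltNge => /ltW Yc.
    by rewrite [leRHS]min_r// ge_min lexx orbT.
Qed.

(** The conditional expectations of one variable are uniformly integrable, so
    their integrals converge with them.  One inequality is Fatou's lemma.  For
    the other, [mine Y c] has a larger integral than [mine Z c] by the previous
    lemma, its integral converges because it is bounded, and [c] is arbitrary.
    The lemma serves for times that tend to infinity, where the [G n] increase,
    and for times that tend to a limit from the right. *)
Lemma cond_exp_limit (G : nat -> set_system Omega) Z (Y : nat -> Omega -> \bar R)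
    (L : Omega -> \bar R) A :
  (forall n, sigma_algebra setT (G n)) -> (forall n, G n `<=` measurable) ->
  (forall n, measurable_wrt (G n) (Y n)) -> (forall n w, 0 <= Y n w)%E ->
  (forall n A, G n A -> \int[P]_(w in A) Y n w = \int[P]_(w in A) Z w)%E ->
  measurable_fun setT Z -> (forall w, 0 <= Z w)%E ->
  measurable_fun setT L -> (forall w, 0 <= L w)%E ->
  {ae P, forall w, Y n w @[n --> \oo] --> L w} ->
  (forall n, G n A) ->
  (\int[P]_(w in A) L w = \int[P]_(w in A) Z w)%E.
Proof.
move=> sG Gm GY Y0 YZ mZ Z0 mL L0 YL GA.
have mA : measurable A by exact: Gm (GA 0%N).
have mY n : measurable_fun setT (Y n) by exact: measurable_wrt_fun (GY n).
have mmin (c : R) (f : Omega -> \bar R) : measurable_fun setT f ->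
    measurable_fun setT (fun w => mine (f w) c%:E).
  by move=> mf; exact: measurable_mine.
have cvg_min (c : R) (u : nat -> \bar R) l : u n @[n --> \oo] --> l ->
    mine (u n) c%:E @[n --> \oo] --> mine l c%:E.
  move=> ul; apply: ereal_cvg_rays => e.
  - rewrite lt_min => /andP[el ec].
    have : \forall n \near \oo, (e%:E <= u n)%E by exact: ereal_cvg_ge_near ul el.
    by apply: filterS => n eu; rewrite le_min eu ltW.
  - rewrite gt_min => /orP[le|ce]; last first.
      by apply: nearW => n; rewrite ge_min (ltW ce) orbT.
    have : \forall n \near \oo, (u n <= e%:E)%E by exact: ereal_cvg_le_near ul le.
    by apply: filterS => n eu; rewrite ge_min eu.
apply/eqP; rewrite eq_le; apply/andP; split.
  by apply: (fatou_ae P Y L A _ mA mY mL Y0 L0 YL) => n; rewrite YZ.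
apply: (fatou_ae P (fun n w => mine (Z w) n%:R%:E) Z A _ mA) => //.
- by move=> n; exact: mmin.
- by move=> n w; rewrite le_min Z0 lee_fin ler0n.
- apply: aeW => w; apply: ereal_cvg_rays => e eZ.
  + have := nbhs_infty_gtr e; apply: filterS => k ek.
    by rewrite le_min !ltW// lte_fin.
  + by apply: nearW => k; rewrite ge_min ltW.
move=> n; apply: (@le_trans _ _ (\int[P]_(w in A) mine (L w) n%:R%:E)%E); last first.
  apply: ge0_le_integral => //.
  + by move=> w _; rewrite le_min L0 lee_fin ler0n.
  + by apply: measurable_funTS; exact: mmin.
  + exact: measurable_funTS.
  + by move=> w _; rewrite ge_min lexx.
have cvgI : (\int[P]_(w in A) mine (Y k w) n%:R%:E)%E @[k --> \oo] -->
    (\int[P]_(w in A) mine (L w) n%:R%:E)%E.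
  have mYn k : measurable_fun A (fun w => mine (Y k w) n%:R%:E).
    by apply: measurable_funTS; exact: mmin.
  have mLn : measurable_fun A (fun w => mine (L w) n%:R%:E).
    by apply: measurable_funTS; exact: mmin.
  have YLn : {ae P, forall w, A w ->
      mine (Y k w) n%:R%:E @[k --> \oo] --> mine (L w) n%:R%:E}.
    by apply: filterS YL => w YLw _; exact: cvg_min.
  have icst : P.-integrable A (cst n%:R%:E).
    exact: finite_measure_integrable_cst.
  have Yn k w : (`|mine (Y k w) n%:R%:E| <= n%:R%:E)%E.
    by rewrite gee0_abs ?le_min ?Y0 ?lee_fin ?ler0n// ge_min lexx orbT.
  have [] := dominated_convergence mA mYn mLn YLn icst; last by [].
  by apply: aeW => w k _; exact: Yn.
rewrite -(cvg_lim _ cvgI)//; apply: lime_ge; first exact/cvgP/cvgI.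
by apply: nearW => k; exact: cond_exp_min (YZ k) (GA k).
Qed.

End ConditionalExpectation.

(** * Martingales closed by a nonnegative random variable *)

Section ClosedMartingales.
Context {d : measure_display} {Omega : measurableType d} {R : realType}.
Context (P : probability Omega R).
Context {disp : Order.disp_t} {I : porderType disp}.
Implicit Types (F : I -> set_system Omega) (X : I -> Omega -> \bar R).

(** [X t] is a version of the conditional expectation of [Z] given [F t], for
    every [t]. *)
Definition closed_by F (Z : Omega -> \bar R) X : Prop :=
  [/\ forall t, measurable_wrt (F t) (X t), forall t w, (0 <= X t w)%E &
      forall t A, F t A -> (\int[P]_(w in A) X t w = \int[P]_(w in A) Z w)%E].

Lemma filtration_le F s t : filtration F -> (s <= t)%O -> F s `<=` F t.
Proof. by move=> [_ _ Finc]; rewrite le_eqVlt => /predU1P[->//|/Finc]. Qed.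

Section Closed.
Context (F : I -> set_system Omega) (Z : Omega -> \bar R)
  (X : I -> Omega -> \bar R).
Hypotheses (filF : filtration F) (iZ : P.-integrable setT Z).
Hypotheses (Z0 : forall w, (0 <= Z w)%E) (ZX : closed_by F Z X).

Lemma closed_by_integrable t : P.-integrable setT (X t).
Proof.
have [Fs Fm _] := filF; have [FX X0 XE] := ZX.
apply/integrableP; split; first exact: measurable_wrt_fun (FX t).
under eq_integral do rewrite gee0_abs//.
rewrite XE; last exact: sigma_algebra_setT.
by move/integrableP : iZ => [_]; under eq_integral do rewrite gee0_abs//.
Qed.

Lemma closed_by_martingale : martingale P F X.
Proof.
have [FX X0 XE] := ZX; split => // [t|s t st].
  by split => //; exact: closed_by_integrable.
exists (X s); split; last exact: aeW.
split => //; first exact: closed_by_integrable.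
by move=> A FA; rewrite !XE//; exact: filtration_le (ltW st) _ FA.
Qed.

Lemma closed_by_supermartingale : nonneg_supermartingale P F X.
Proof.
have [FX X0 XE] := ZX; split => // s t A st FA.
by rewrite !XE//; exact: filtration_le st _ FA.
Qed.

Lemma filtration_infty_measurable : filtration_infty F `<=` measurable.
Proof.
have [_ Fm _] := filF.
apply: smallest_sub; first exact: sigma_algebra_measurable.
by move=> A [t _ /Fm].
Qed.

(** Levy's upward theorem.  On a set of [F t] the limit has the integral of [Z]
    by uniform integrability; such sets form a pi-system that generates the
    sigma-algebra for which both variables are measurable. *)
Lemma levy_upward (e : nat -> I) (L : Omega -> \bar R) :
  (forall t, exists N, forall n, (N <= n)%N -> (t <= e n)%O) ->
  measurable_wrt (filtration_infty F) Z ->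
  measurable_wrt (filtration_infty F) L -> (forall w, 0 <= L w)%E ->
  {ae P, forall w, X (e n) w @[n --> \oo] --> L w} ->
  {ae P, forall w, Z w = L w}.
Proof.
move=> ecof FZ FL L0 XL.
have [Fs Fm Finc] := filF; have [FX X0 XE] := ZX.
have Foom := filtration_infty_measurable.
have mZ := measurable_int _ iZ.
have mL := measurable_wrt_fun _ _ Foom FL.
have base t A : F t A -> (\int[P]_(w in A) Z w = \int[P]_(w in A) L w)%E.
  (* From the index [N] on, [A] is known at the times considered. *)
  move=> FA; have [N tN] := ecof t.
  apply/esym/(cond_exp_limit P (fun n => F (e (n + N)%N)) Z
    (fun n => X (e (n + N)%N)) L A) => //.
  - by move=> n B; exact: XE.
  - by apply: filterS XL => w; rewrite -(cvg_shiftn N).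
  - by move=> n; apply: filtration_le (tN _ (leq_addl _ _)) _ FA.
have cupI : setI_closed (\bigcup_t F t).
  move=> A B [s _ FA] [t _ FB].
  have [N sN] := ecof s; have [M tM] := ecof t.
  exists (e (maxn N M)) => //; apply: sigma_algebra_setI => //.
  - by apply: filtration_le FA => //; exact/sN/leq_maxl.
  - by apply: filtration_le FB => //; exact/tM/leq_maxr.
have t0 := e 0%N.
have ZLT := base t0 setT (sigma_algebra_setT _ (Fs t0)).
apply: (sub_integral_ae_eq P (\bigcup_t F t)) => //.
apply: (@dynkin_induction _ (g_sigma_algebraType (\bigcup_t F t)) (\bigcup_t F t)) => //.
- by move=> A [t _]; exact: base.
- move=> A /Foom mA ZLA.
  have fA : (\int[P]_(w in A) Z w)%E \is a fin_num.
    by apply: integrable_fin_num => //; exact: integrableS iZ.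
  move: ZLT; rewrite (ge0_integral_setID P Z setT A)//.
  rewrite (ge0_integral_setID P L setT A)// !setTI -ZLA !setTD.
  rewrite addeC [in RHS]addeC => /(congr1 (fun z => z - \int[P]_(w in A) Z w)%E).
  by rewrite !addeK.
- move=> A mA tA ZLA.
  rewrite !ge0_integral_bigcup//.
  + by apply: eq_eseriesr => i _; exact: ZLA.
  + by move=> i; exact: (Foom _ (mA i)).
  + exact: measurable_funTS.
  + by move=> i; exact: (Foom _ (mA i)).
  + exact: measurable_funTS.
Qed.

(** The limit exists by assumption, so that it may be identified along the
    sequence [e] of times. *)
Lemma closed_by_limit (Phi : set_system I) (e : nat -> I) :
  e n @[n --> \oo] `=>` Phi ->
  (forall t, exists N, forall n, (N <= n)%N -> (t <= e n)%O) ->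
  measurable_wrt (filtration_infty F) Z ->
  converges_ae P Phi X -> is_limit_variable P Phi X Z.
Proof.
move=> ePhi ecof FZ cX; have [FX X0 _] := ZX.
have FXoo t : measurable_wrt (filtration_infty F) (X t).
  apply: measurable_wrtS (FX t) => A FA.
  by apply: sub_sigma_algebra; exists t.
split => //; first exact: measurable_int iZ.
have cvge w (l : \bar R) : X t w @[t --> Phi] --> l -> X (e n) w @[n --> \oo] --> l.
  by move=> Xl A Al; exact: (ePhi _ (Xl A Al)).
pose L w := limn_esup (fun n => X (e n) w).
have ZL : {ae P, forall w, Z w = L w}.
  apply: (levy_upward e) => //.
  - apply: (measurable_wrt_limn_esup _ (fun n => X (e n))) => //.
    exact: smallest_sigma_algebra.
  - by move=> w; exact: limf_esup_ge0.
  - apply: filterS cX => w [l /cvge Xl].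
    by rewrite /L (cvg_limn_einf_sup Xl).2.
apply: filterS2 cX ZL => w [l Xl] ->.
by rewrite /L (cvg_limn_einf_sup (cvge _ _ Xl)).2.
Qed.

End Closed.

Lemma cond_exp_process F Z : filtration F -> P.-integrable setT Z ->
  (forall w, 0 <= Z w)%E -> exists X, closed_by F Z X.
Proof.
move=> [Fs Fm _] iZ Z0.
have [X XE] := choice (fun t => cond_exp_exists P (F t) Z (Fs t) (Fm t) iZ Z0).
exists X; split => [t|t|t].
- by have [[]] := XE t.
- by have [] := XE t.
- by have [[_ _]] := XE t.
Qed.

End ClosedMartingales.

(** * Right-continuous versions *)

Lemma limn_esup_shift {R : realType} (u : (\bar R)^nat) N :
  limn_esup (fun n => u (n + N)%N) = limn_esup u.
Proof.
rewrite !limn_esup_lim; apply/cvg_lim => //.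
rewrite (_ : esups (fun n => u (n + N)%N) = (fun n => esups u (n + N)%N)).
  have : esups u n @[n --> \oo] --> limn (esups u) by exact: is_cvg_esups.
  by rewrite -(cvg_shiftn N).
apply/funext => n; congr ereal_sup; apply/seteqP; split => _ [k /= nk <-].
  by exists (k + N)%N => //=; rewrite leq_add2r.
have Nk : (N <= k)%N by exact: leq_trans (leq_addl n N) nk.
by exists (k - N)%N; rewrite /= ?subnK// leq_subRL// addnC.
Qed.

Section RightContinuousVersion.
Context {d : measure_display} {Omega : measurableType d} {R : realType}.
Context (P : probability Omega R).
Local Notation T := {nonneg R}.

Lemma rational_time_above (t : T) : exists r : nat -> nat, forall n,
  (t < rational_time (r n) < (t%:num + n.+1%:R^-1)%:nng)%O.
Proof.
have above n : exists k, (t < rational_time k < (t%:num + n.+1%:R^-1)%:nng)%O.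
  by apply: rational_time_dense; rewrite -[(_ < _)%O]/(_ < _ :> R)/= ltrDl.
by have [r rP] := choice above; exists r.
Qed.

Definition time_above (t : T) (n : nat) : T :=
  rational_time (sval (cid (rational_time_above t)) n).

Lemma time_above_gt t n : (t < time_above t n)%O.
Proof. by rewrite /time_above; case: cid => r /= /(_ n)/andP[]. Qed.

Lemma time_above_lt (t u : T) : (t < u)%O ->
  \forall n \near \oo, (time_above t n < u)%O.
Proof.
move=> tu; have tu0 : 0 < u%:num - t%:num by rewrite subr_gt0.
have := near_infty_natSinv_lt (PosNum tu0).
apply: filterS => n nu; rewrite /time_above; case: cid => r /= /(_ n)/andP[_].
move=> /lt_trans; apply; rewrite -[(_ < _)%O]/(_ < _ :> R)/=.
by rewrite -ltrBrDl.
Qed.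

Lemma time_above_right t :
  time_above t n @[n --> \oo] `=>` sampled_right rational_time t.
Proof.
move=> A [u /= tu uA]; have := time_above_lt _ _ tu.
apply: filterS => n nu; apply: uA; split; first by eexists.
by rewrite time_above_gt.
Qed.

Context (F : T -> set_system Omega) (Z : Omega -> \bar R).
Hypotheses (filF : filtration F) (usualF : usual_conditions P F).
Hypotheses (iZ : P.-integrable setT Z) (Z0 : forall w, (0 <= Z w)%E).

(** Only countably many conditional expectations [Y] enter the construction:
    [X t] is their limit along rational times decreasing to [t].  Almost surely
    these limits exist for all [t] at once because the path of [Y] has boundedly
    many upcrossings, and [X t] is measurable at time [t] because the filtration
    is right-continuous. *)
Lemma right_continuous_version :
  exists X, closed_by P F Z X /\ right_continuous_paths P X.
Proof.
have [Fs Fm Finc] := filF.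
have [Y ZY] := cond_exp_process P F Z filF iZ Z0; have [FY Y0 YE] := ZY.
have sY := closed_by_supermartingale P F Z Y filF ZY.
pose X (t : T) w := limn_esup (fun n => Y (time_above t n) w).
have FX t : measurable_wrt (F t) (X t).
  (* If [t < s] then [time_above t n] is below [s] from some index on, and the
     upper limit does not depend on the earlier ones. *)
  have Fright : measurable_wrt (\bigcap_(s in [set s | (t < s)%O]) F s) (X t).
    move=> A XA s /= ts; have [N _ Ns] := time_above_lt _ _ ts.
    apply: (_ : measurable_wrt (F s) (X t)) XA => //.
    rewrite (_ : X t = (fun w => limn_esup (fun n => Y (time_above t (n + N)) w))).
      apply: (measurable_wrt_limn_esup _ (fun n => Y (time_above t (n + N)))) => //.
      move=> n; apply: measurable_wrtS (FY _); apply: Finc; apply: Ns.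
      by rewrite /= leq_addl.
    apply/funext => w.
    by rewrite (limn_esup_shift (fun n => Y (time_above t n) w)).
  by rewrite (usualF.2 t).
have X0 t w : (0 <= X t w)%E by exact: limf_esup_ge0.
have YX : {ae P, forall w t, Y v w @[v --> sampled_right rational_time t] --> X t w}.
  apply: filterS (bounded_upcrossings_ae P F Y sY rational_time) => w Yw t.
  have [l Yl] := cvg_sampled_right _ _ (Y0 ^~ w) Yw _ _ (nonneg_gt t).
  have Ytl : Y (time_above t n) w @[n --> \oo] --> l.
    by move=> A Al; exact: (time_above_right t _ (Yl A Al)).
  by rewrite /X (cvg_limn_einf_sup Ytl).2.
exists X; split; last first.
  by apply: filterS YX => w YXw t; exact: (sampled_right_continuous (X^~ w) _ t YXw).
split => // t A FA.
apply: (cond_exp_limit P (F \o time_above t) Z (Y \o time_above t)) => //=.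
- by move=> n B; exact: YE.
- exact: measurable_int iZ.
- exact: measurable_wrt_fun (FX t).
- by apply: filterS YX => w /(_ t) Yw B XB; exact: (time_above_right t _ (Yw B XB)).
- by move=> n; exact: Finc (time_above_gt t n) _ FA.
Qed.

End RightContinuousVersion.

(** * Bayes factors as limits of martingales *)

Section BayesFactorMartingales.
Context {d : measure_display} {Omega : measurableType d} {R : realType}.
Context (P : probability Omega R) (B : Omega -> \bar R).
Hypothesis preciseB : precise_bayes_factor P B.

Local Notation Z := (fun w => (B w)^-1)%E.

Let mB : measurable_fun setT B. Proof. by have [[]] := preciseB. Qed.

Let mZ : measurable_fun setT Z.
Proof. exact: measurableT_comp measurable_inve mB. Qed.

Let Z0 w : (0 <= Z w)%E.
Proof. by rewrite inve_ge0; have [[]] := preciseB. Qed.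

Let iZ : P.-integrable setT Z.
Proof.
apply/integrableP; split => //; under eq_integral do rewrite gee0_abs//.
by rewrite preciseB.2 ltry.
Qed.

Let wrtZ G : measurable_wrt G B -> measurable_wrt G Z.
Proof.
move=> GB _ [Y mY <-]; apply: GB; exists ((fun x => x^-1)%E @^-1` Y) => //.
by rewrite -[X in measurable X]setTI; exact: measurable_inve.
Qed.

Section AnyTime.
Context {disp : Order.disp_t} {I : porderType disp}.
Implicit Types (Phi : set_system I) (F : I -> set_system Omega)
  (X : I -> Omega -> \bar R).

Lemma closed_test_martingale F X t0 : filtration F -> closed_by P F Z X ->
  test_martingale_from P t0 F X.
Proof.
move=> filF ZX; have [FX X0 XE] := ZX; split => //.
- exact: (closed_by_martingale P F Z X filF iZ Z0 ZX).
- by rewrite XE ?preciseB.2//; have [Fs _ _] := filF; exact: sigma_algebra_setT.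
Qed.

Lemma limit_inverse Phi X :
  is_limit_variable P Phi X Z -> inverse_of_limit P Phi X B.
Proof. by exists Z; split => //; apply: aeW => w; rewrite inveK. Qed.

(** [Z] is its own conditional expectation given the sigma-algebra that it
    generates, and equal to the limit of the constant process. *)
Lemma constant_test_martingale t0 :
  let X := fun _ : I => Z in
  test_martingale_from P t0 (natural_filtration X) X /\
  forall Phi, Filter Phi -> inverse_of_limit P Phi X B.
Proof.
move=> X; split; last first.
  move=> Phi FPhi; apply: limit_inverse; split => //.
  by apply: aeW => w; exact: cvg_cst.
apply: closed_test_martingale.
  split => [t|t|s t st].
  - exact: smallest_sigma_algebra.
  - apply: smallest_sub; first exact: sigma_algebra_measurable.
    by move=> _ [s _ [Y mY <-]]; exact: mZ.
  - apply: sub_smallest2r; first exact: smallest_sigma_algebra.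
    by move=> A [u us XA]; exists u => //; exact: le_trans us (ltW st).
split => // t A XA; apply: sub_sigma_algebra; exists t => //=.
Qed.

End AnyTime.

Lemma filtration_test_martingale_discrete (F : nat -> set_system Omega) :
  filtration F -> measurable_wrt (filtration_infty F) B ->
  exists X, test_martingale_discrete P F X /\ inverse_of_limit P \oo X B.
Proof.
move=> filF FB; have [X ZX] := cond_exp_process P F Z filF iZ Z0.
exists X; split; first exact: closed_test_martingale.
apply: limit_inverse; apply: (closed_by_limit P F Z X filF iZ Z0 ZX _ id) => //.
- by move=> t; exists t.
- exact: wrtZ.
- exact: doob_discrete (closed_by_supermartingale P F Z X filF ZX).
Qed.

Lemma filtration_test_martingale_continuous (F : {nonneg R} -> set_system Omega) :
  filtration F -> usual_conditions P F ->
  measurable_wrt (filtration_infty F) B ->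
  exists X, test_martingale_continuous P F X /\
    inverse_of_limit P infty_continuous X B.
Proof.
move=> filF usualF FB.
have [X [ZX Xr]] := right_continuous_version P F Z filF usualF iZ Z0.
exists X; split; first by split => //; exact: closed_test_martingale.
apply: limit_inverse.
apply: (closed_by_limit P F Z X filF iZ Z0 ZX _ _ nat_times_infty) => //.
- move=> t; have [N _ tN] := nbhs_infty_ger t%:num.
  by exists N => n /tN tn; rewrite -[(_ <= _)%O]/(t%:num <= `|n%:R|) ger0_norm.
- exact: wrtZ.
- exact: doob_continuous (closed_by_supermartingale P F Z X filF ZX) Xr.
Qed.

End BayesFactorMartingales.

Theorem theorem1 (d : measure_display) (Omega : measurableType d)
    (R : realType) (P : probability Omega R) :
  ((forall (F : nat -> set_system Omega) (X : nat -> Omega -> \bar R),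
      test_supermartingale_discrete P F X ->
      limit_gives_bayes_factor P \oo X) /\
   (forall (F : {nonneg R} -> set_system Omega)
           (X : {nonneg R} -> Omega -> \bar R),
      test_supermartingale_continuous P F X ->
      limit_gives_bayes_factor P infty_continuous X)) /\
  (forall B : Omega -> \bar R, precise_bayes_factor P B ->
    [/\ exists X : nat -> Omega -> \bar R,
          own_test_martingale_discrete P X /\ inverse_of_limit P \oo X B,
        exists X : {nonneg R} -> Omega -> \bar R,
          own_test_martingale_continuous P X /\
          inverse_of_limit P infty_continuous X B,
        forall F : nat -> set_system Omega, filtration F ->
          measurable_wrt (filtration_infty F) B ->
          exists X : nat -> Omega -> \bar R,
            test_martingale_discrete P F X /\ inverse_of_limit P \oo X B &
        forall F : {nonneg R} -> set_system Omega, filtration F ->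
          usual_conditions P F ->
          measurable_wrt (filtration_infty F) B ->
          exists X : {nonneg R} -> Omega -> \bar R,
            test_martingale_continuous P F X /\
            inverse_of_limit P infty_continuous X B]).
Proof.
split.
  split=> F X.
  - exact: test_supermartingale_discrete_bayes_factor.
  - exact: test_supermartingale_continuous_bayes_factor.
move=> B preciseB; split.
- have [martX limX] := constant_test_martingale P B preciseB (0%N : nat).
  by exists (fun=> fun w => ((B w)^-1)%E); split => //; exact: limX.
- have [martX limX] := constant_test_martingale P B preciseB (0%:nng : {nonneg R}).
  exists (fun=> fun w => ((B w)^-1)%E); split.
    by split => //; apply: aeW => w t; exact: cvg_cst.
  by apply: limX; exact: fmap_filter.
- exact: filtration_test_martingale_discrete.
- exact: filtration_test_martingale_continuous.
Qed.
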